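(* Let $I$ be a quasi prime and radical right ideal of $\mathbb{H}[q_1,\ldots,q_n]$. Then $\mathcal{V}_c(I)$ cannot be written as a non-trivial union of the form $\mathcal{V}_c(I_1)\cup\mathcal{V}_c(I_2)$, with $I_1,I_2$ right ideals of $\mathbb{H}[q_1,\ldots,q_n]$, where either $\mathcal{V}_c(I_1)$ or $\mathcal{V}_c(I_2)$ has spherical symmetry.
   Context: $\mathbb{H}$ is the skew field of quaternions, $\mathbb{S}=\{J\in\mathbb{H}: J^2=-1\}$, and for $K\in\mathbb{S}$, $\mathbb{C}_K=\mathbb{R}+\mathbb{R}K$. $\mathbb{H}[q_1,\ldots,q_n]$ is the set of slice regular polynomials, i.e. functions $P:\mathbb{H}^n\to\mathbb{H}$, $P(q_1,\ldots,q_n)=\sum q_1^{\ell_1}\cdots q_n^{\ell_n}a_{\ell_1,\ldots,\ell_n}$ (finite sum, variables in this order, coefficients in $\mathbb{H}$ on the right). It is a ring under pointwise sum and the $*$-product determined by $(q^{\ell}a)*(q^{m}b)=q^{\ell+m}ab$ for multi-indices $\ell,m$, where $q^\ell=q_1^{\ell_1}\cdots q_n^{\ell_n}$. For a right ideal $I$, $\mathcal{V}(I)\subseteq\mathbb{H}^n$ is the set of common zeros of all $P\in I$, and $\mathcal{V}_c(I)=\mathcal{V}(I)\cap\bigcup_{K\in\mathbb{S}}\mathbb{C}_K^n$. The regular conjugate of $P=\sum q^\ell a_\ell$ is $P^c=\sum q^\ell\,\overline{a_\ell}$; the symmetrization of $P$ is $P^s=P*P^c=P^c*P$. A right ideal $J$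 is completely prime if, whenever $P*Q\in J$ and $P*J\subseteq J$, either $P\in J$ or $Q\in J$. The radical $\sqrt{I}$ of a right ideal $I$ is the intersection of all completely prime right ideals containing $I$; $I$ is radical if $\sqrt{I}=I$. A right ideal $I$ is quasi prime if, whenever $P*Q\in I$, either $P\in I$ or $Q^s\in I$. For $\mathbf{a}=(a_1,\ldots,a_n)\in\mathbb{H}^n$, $\mathbb{S}_{\mathbf{a}}=\{(g^{-1}a_1g,\ldots,g^{-1}a_ng): g\in\mathbb{H}\setminus\{0\}\}$. The set $\mathcal{V}_c(I)$ has spherical symmetry if $\mathcal{V}_c(I)=\mathbb{S}_{\mathcal{V}_c(I)}:=\bigcup_{\mathbf{a}\in\mathcal{V}_c(I)}\mathbb{S}_{\mathbf{a}}$. A union $\mathcal{V}_c(I_1)\cup\mathcal{V}_c(I_2)$ is non-trivial if neither of the two sets is contained in the other. *)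

(* Defs.v *)
(* Mathematical Components, with Multinomials for the polynomial ring. *)
From HB Require Import structures.
From mathcomp Require Import all_boot all_order all_algebra.
From mathcomp Require Import boolp classical_sets reals.
From mathcomp Require Import ssrcomplements mpoly.
From mathcomp Require Import ring.

Set Implicit Arguments.
Unset Strict Implicit.
Unset Printing Implicit Defensive.

Import Order.TTheory GRing.Theory Num.Theory.

Local Open Scope classical_set_scope.
Local Open Scope ring_scope.

(* Quat a b c d stands for a + b i + c j + d k. *)
Record quaternion (R : realType) := Quat { q0 : R; q1 : R; q2 : R; q3 : R }.

Section Quaternion.
Variable R : realType.
Local Notation H := (quaternion R).
Implicit Types x y z : H.

Definition quat_to_tuple x := (q0 x, q1 x, q2 x, q3 x).
Definition quat_of_tuple (t : R * R * R * R) : H :=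
  let: (a, b, c, d) := t in Quat a b c d.

Lemma quat_to_tupleK : cancel quat_to_tuple quat_of_tuple.
Proof. by case. Qed.

HB.instance Definition _ := Choice.copy H (can_type quat_to_tupleK).

Lemma quatP x y :
  q0 x = q0 y -> q1 x = q1 y -> q2 x = q2 y -> q3 x = q3 y -> x = y.
Proof. by case: x y => [a b c d] [a' b' c' d'] /= -> -> -> ->. Qed.

Definition quat_zero : H := Quat 0 0 0 0.
Definition quat_one : H := Quat 1 0 0 0.
Definition quat_opp x : H := Quat (- q0 x) (- q1 x) (- q2 x) (- q3 x).
Definition quat_add x y : H :=
  Quat (q0 x + q0 y) (q1 x + q1 y) (q2 x + q2 y) (q3 x + q3 y).
Definition quat_mul x y : H :=
  Quat (q0 x * q0 y - q1 x * q1 y - q2 x * q2 y - q3 x * q3 y)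
       (q0 x * q1 y + q1 x * q0 y + q2 x * q3 y - q3 x * q2 y)
       (q0 x * q2 y - q1 x * q3 y + q2 x * q0 y + q3 x * q1 y)
       (q0 x * q3 y + q1 x * q2 y - q2 x * q1 y + q3 x * q0 y).

Fact quat_addA : associative quat_add.
Proof. by move=> x y z; apply: quatP; rewrite /= addrA. Qed.
Fact quat_addC : commutative quat_add.
Proof. by move=> x y; apply: quatP; rewrite /= addrC. Qed.
Fact quat_add0 : left_id quat_zero quat_add.
Proof. by move=> x; apply: quatP; rewrite /= add0r. Qed.
Fact quat_addN : left_inverse quat_zero quat_opp quat_add.
Proof. by move=> x; apply: quatP; rewrite /= addNr. Qed.

HB.instance Definition _ :=
  GRing.isZmodule.Build H quat_addA quat_addC quat_add0 quat_addN.

Fact quat_mulA : associative quat_mul.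
Proof. by move=> x y z; apply: quatP => /=; ring. Qed.
Fact quat_mul1x : left_id quat_one quat_mul.
Proof. by move=> x; apply: quatP => /=; ring. Qed.
Fact quat_mulx1 : right_id quat_one quat_mul.
Proof. by move=> x; apply: quatP => /=; ring. Qed.
Fact quat_mulDl : left_distributive quat_mul quat_add.
Proof. by move=> x y z; apply: quatP => /=; ring. Qed.
Fact quat_mulDr : right_distributive quat_mul quat_add.
Proof. by move=> x y z; apply: quatP => /=; ring. Qed.
Fact quat_one_neq0 : quat_one != quat_zero.
Proof. by apply/eqP => -[] /eqP; rewrite oner_eq0. Qed.

HB.instance Definition _ :=
  GRing.Zmodule_isNzRing.Build H quat_mulA quat_mul1x quat_mulx1
    quat_mulDl quat_mulDr quat_one_neq0.

Definition quat_real (t : R) : H := Quat t 0 0 0.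

Definition quat_conj x : H := Quat (q0 x) (- q1 x) (- q2 x) (- q3 x).

Fact quat_conj_is_zmod_morphism : zmod_morphism quat_conj.
Proof. by move=> x y; apply: quatP => /=; ring. Qed.
HB.instance Definition _ :=
  GRing.isZmodMorphism.Build H H quat_conj quat_conj_is_zmod_morphism.

Definition quat_sqnorm x : R :=
  q0 x ^+ 2 + q1 x ^+ 2 + q2 x ^+ 2 + q3 x ^+ 2.

Lemma quat_sqnorm_eq0 x : (quat_sqnorm x == 0) = (x == 0).
Proof.
rewrite /quat_sqnorm !paddr_eq0 ?addr_ge0 ?sqr_ge0 // !sqrf_eq0.
apply/idP/eqP => [|->]; last by rewrite !eqxx.
by case/andP => /andP[/andP[/eqP ? /eqP ?] /eqP ?] /eqP ?; apply: quatP.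
Qed.

Definition quat_inv x : H := quat_real (quat_sqnorm x)^-1 * quat_conj x.

Definition quat_unit : pred H := [pred x | x != 0].

Fact quat_mulVx : {in quat_unit, left_inverse 1 quat_inv *%R}.
Proof.
move=> x; rewrite inE -quat_sqnorm_eq0 => nx.
by apply: quatP => /=; rewrite -?(mulVf nx) /quat_sqnorm; ring.
Qed.
Fact quat_mulxV : {in quat_unit, right_inverse 1 quat_inv *%R}.
Proof.
move=> x; rewrite inE -quat_sqnorm_eq0 => nx.
by apply: quatP => /=; rewrite -?(mulVf nx) /quat_sqnorm; ring.
Qed.
Fact quat_unitP x y : y * x = 1 /\ x * y = 1 -> quat_unit x.
Proof.
move=> [yx1 _]; apply/eqP => x0; move: yx1; rewrite x0 mulr0 => /eqP.
by rewrite eq_sym oner_eq0.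
Qed.
Fact quat_inv_out : {in [predC quat_unit], quat_inv =1 id}.
Proof.
move=> x; rewrite inE /= negbK => /eqP ->.
by rewrite /quat_inv raddf0 mulr0.
Qed.

HB.instance Definition _ :=
  GRing.NzRing_hasMulInverse.Build H quat_mulVx quat_mulxV quat_unitP
    quat_inv_out.

Definition imag_units : set H := [set J | J ^+ 2 = - 1].

Definition slice (K : H) : set H :=
  [set z | exists s t : R, z = quat_real s + quat_real t * K].

End Quaternion.

(* A slice regular polynomial \sum q^l a_l is represented by the family of its
   coefficients, as an element of {mpoly quaternion R[n]}, whose product makes
   the indeterminates central and hence is the *-product (slice_mul_monomial).
   Only the evaluation has to be redefined: mpoly's own meval puts coefficients
   on the left.  By slice_eval_inj these are the same thing as the polynomial
   functions. *)
Section SlicePolynomials.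
Variables (R : realType) (n : nat).
Local Notation H := (quaternion R).
Implicit Types (P Q F : {mpoly H[n]}) (a b : 'I_n -> H).
Implicit Types (I J : set {mpoly H[n]}) (V : set ('I_n -> H)).

(* \prod_(i < n) is the ordered product a_0^l_0 * ... * a_(n-1)^l_(n-1). *)
Definition slice_eval P a : H :=
  \sum_(m <- msupp P) (\prod_(i < n) a i ^+ m i) * P@_m.

Lemma slice_mul_monomial (l m : 'X_{1..n}) (c d : H) :
  (c *: 'X_[l]) * (d *: 'X_[m]) = (c * d) *: 'X_[l + m] :> {mpoly H[n]}.
Proof.
rewrite -!mul_mpolyC mpolyCM mpolyXD -!mulrA; congr (_ * _).
by rewrite !mulrA; congr (_ * _); rewrite commr_mpolyX.
Qed.

Lemma slice_eval_monomial (l : 'X_{1..n}) (c : H) a :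
  slice_eval (c *: 'X_[l]) a = (\prod_(i < n) a i ^+ l i) * c.
Proof.
rewrite /slice_eval; have [->|c0] := eqVneq c 0.
  by rewrite scale0r msupp0 big_nil mulr0.
by rewrite msuppMCX // big_seq1 mcoeffZ mcoeffX eqxx mulr1.
Qed.

Definition right_ideal I : Prop :=
  [/\ I 0, forall P Q, I P -> I Q -> I (P + Q) & forall P Q, I P -> I (P * Q)].

Definition zero_set I : set ('I_n -> H) :=
  [set a | forall P, I P -> slice_eval P a = 0].

Definition czero_set I : set ('I_n -> H) :=
  zero_set I `&`
  \bigcup_(K in @imag_units R) [set a | forall i, slice K (a i)].

Definition reg_conj P : {mpoly H[n]} := map_mpoly (@quat_conj R) P.

Definition symmetrization P : {mpoly H[n]} := P * reg_conj P.

Definition completely_prime J : Prop :=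
  right_ideal J /\
  forall P Q, J (P * Q) -> (forall F, J F -> J (P * F)) -> J P \/ J Q.

Definition radical I : set {mpoly H[n]} :=
  \bigcap_(J in [set J | completely_prime J /\ I `<=` J]) J.

Definition is_radical I : Prop := radical I = I.

Definition quasi_prime I : Prop :=
  forall P Q, I (P * Q) -> I P \/ I (symmetrization Q).

Definition sphere a : set ('I_n -> H) :=
  [set b | exists2 g : H, g != 0 & b = (fun i => g^-1 * a i * g)].

Definition spherical_symmetry V : Prop := V = \bigcup_(a in V) sphere a.

End SlicePolynomials.

Section PolynomialFunctions.
Variables (R : realType) (n : nat).
Local Notation H := (quaternion R).
Implicit Types (P Q : {mpoly H[n]}) (a : 'I_n -> H).

Lemma symmetrizationC P : symmetrization P = reg_conj P * P.
Proof.
apply/eqP; rewrite -subr_eq0; apply/eqP/mpolyP => m.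
rewrite mcoeffB !mcoeffM mcoeff0 -sumrB.
set S := \sum_(_ | _) _.
suff SN : S = - S.
  have xN (x : R) : x = - x -> x = 0.
    by move/eqP; rewrite -addr_eq0 -mulr2n mulrn_eq0 /= => /eqP.
  by apply: quatP; apply: xN; rewrite [in LHS]SN.
rewrite {1}/S (reindex_inj (h := fun k => (k.2, k.1))); last first.
  by move=> [? ?] [? ?] [-> ->].
rewrite -sumrN; apply: eq_big => [k|k _] /=; first by rewrite addmC.
rewrite !mcoeff_map_mpoly; apply: quatP => /=; ring.
Qed.

Lemma kron_inj (B : nat) k (f g : 'I_k -> nat) :
  (forall i, f i < B)%N -> (forall i, g i < B)%N ->
  (\sum_(i < k) f i * B ^ i = \sum_(i < k) g i * B ^ i)%N -> f =1 g.
Proof.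
elim: k f g => [|k IH] f g fB gB; first by move=> _ [].
have B0 : (0 < B)%N by apply: leq_ltn_trans (fB ord0).
have E (h : 'I_k.+1 -> nat) : (\sum_(i < k.+1) h i * B ^ i =
    (\sum_(i < k) h (lift ord0 i) * B ^ i) * B + h ord0)%N.
  rewrite big_ord_recl expn0 muln1 addnC big_distrl /=; congr (_ + _)%N.
  by apply: eq_bigr => i _; rewrite expnSr mulnA.
rewrite !E => eq_fg i.
have e0 : f ord0 = g ord0.
  by have := congr1 (modn^~ B) eq_fg; rewrite /= !modnMDl !modn_small.
have /IH es : (\sum_(i < k) f (lift ord0 i) * B ^ i =
    \sum_(i < k) g (lift ord0 i) * B ^ i)%N.
  have := congr1 (divn^~ B) eq_fg.
  by rewrite /= !divnMDl // !(divn_small (fB _)) !(divn_small (gB _)) !addn0.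
by case: (unliftP ord0 i) => [j|] -> //; apply: es.
Qed.

Lemma power_sum_eq0 (T : finType) (e : T -> nat) (c : T -> R) :
  injective e -> (forall t, \sum_(m : T) t ^+ e m * c m = 0) ->
  forall m, c m = 0.
Proof.
move=> inj_e sum0 m; pose p : {poly R} := \sum_(m : T) c m *: 'X^(e m).
have p0 : p = 0.
  apply: (@roots_geq_poly_eq0 _ _ [seq k%:R | k <- iota 0 (size p)]).
  - apply/allP => _ /mapP[k _ ->]; rewrite rootE horner_sum -[X in _ == X](sum0 k%:R).
    by apply/eqP/eq_bigr => x _; rewrite hornerZ hornerXn mulrC.
  - by rewrite map_inj_uniq ?iota_uniq // => i j /eqP; rewrite eqr_nat => /eqP.
  - by rewrite size_map size_iota.
have := congr1 (fun q : {poly R} => q`_(e m)) p0.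
rewrite /p coef0 coef_sum (bigD1 m) //= coefZ coefXn eqxx mulr1 big1 ?addr0 //.
move=> x xm; rewrite coefZ coefXn (inj_eq inj_e) eq_sym (negPf xm) mulr0 //.
Qed.

Lemma slice_evalE P a k : (msize P <= k)%N ->
  slice_eval P a = \sum_(m : 'X_{1..n < k}) (\prod_(i < n) a i ^+ m i) * P@_m.
Proof.
move=> le_Pk; pose I : subFinType _ := 'X_{1..n < k}.
rewrite /slice_eval (big_mksub I) ?msupp_uniq //=; first last.
  by move=> x /msize_mdeg_lt /leq_trans; apply.
by rewrite big_rmcond //= => j /memN_msupp_eq0 ->; rewrite mulr0.
Qed.

(* Kronecker substitution a_i = t ^ (k ^ i), with t real. *)
Lemma slice_eval_inj P Q :
  (forall a, slice_eval P a = slice_eval Q a) -> P = Q.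
Proof.
move=> eqPQ; pose k := maxn (msize P) (msize Q).
have leP : (msize P <= k)%N by rewrite leq_maxl.
have leQ : (msize Q <= k)%N by rewrite leq_maxr.
pose e (m : 'X_{1..n < k}) := (\sum_(i < n) m i * k ^ i)%N.
have inj_e : injective e.
  have ltk (m : 'X_{1..n < k}) i : (m i < k)%N.
    apply: leq_ltn_trans (bmdeg m); rewrite mdegE (bigD1 i) //=; exact: leq_addr.
  by move=> m1 m2 /kron_inj eq12; apply/val_inj/mnmP/eq12; apply: ltk.
have realX t d : quat_real t ^+ d = quat_real (t ^+ d) :> H.
  elim: d => [|d IH]; first by apply: quatP.
  by rewrite !exprS IH; apply: quatP => /=; ring.
have eval t : \sum_(m : 'X_{1..n < k}) quat_real (t ^+ e m) * (P - Q)@_m = 0.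
  have := eqPQ (fun i => quat_real (t ^+ (k ^ i))).
  rewrite !(@slice_evalE _ _ k) // => /eqP; rewrite -subr_eq0 -sumrB => /eqP.
  move=> S0; rewrite -[RHS]S0; apply: eq_bigr => m _; rewrite mcoeffB -mulrBr; congr (_ * _).
  rewrite /e; elim/big_rec2: _ => [|i x y _ IH]; first by apply: quatP.
  rewrite -IH realX exprD mulnC exprM.
  by apply: quatP => /=; ring.
have comp (q : H -> R) : q 0 = 0 -> (forall x y, q (x + y) = q x + q y) ->
    (forall t x, q (quat_real t * x) = t * q x) ->
    forall m : 'X_{1..n < k}, q (P - Q)@_m = 0.
  move=> q_0 qD qZ; apply: (power_sum_eq0 inj_e) => t.
  rewrite -[RHS]q_0 -(eval t) (big_morph q qD q_0).
  by apply: eq_bigr => m _; rewrite qZ.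
apply/eqP; rewrite -subr_eq0; apply/eqP/mpolyP => m; rewrite mcoeff0.
have [ltm|] := ltnP (mdeg m) k; last first.
  move=> lekm; rewrite mcoeffB !memN_msupp_eq0 ?subr0 //; apply/negP.
    by move=> /msize_mdeg_lt; rewrite ltnNge (leq_trans leQ).
  by move=> /msize_mdeg_lt; rewrite ltnNge (leq_trans leP).
apply: quatP.
- by apply: (comp _ _ _ _ (BMultinom ltm)) => // t x /=; ring.
- by apply: (comp _ _ _ _ (BMultinom ltm)) => // t x /=; ring.
- by apply: (comp _ _ _ _ (BMultinom ltm)) => // t x /=; ring.
- by apply: (comp _ _ _ _ (BMultinom ltm)) => // t x /=; ring.
Qed.

End PolynomialFunctions.

(* Main.v *)
Require Import Defs.
From HB Require Import structures.
From mathcomp Require Import all_boot all_order all_algebra.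
From mathcomp Require Import boolp classical_sets functions cardinality reals.
From mathcomp Require Import complex finmap mpoly.
From mathcomp Require Import ring.
From mathcomp Require lebesgue_measure.

(** Evaluation of slice regular polynomials is twisted: at a point a whose
    coordinates commute, either P(a) = 0 and then (P * Q)(a) = 0, or
    (P * Q)(a) = P(a) Q(P(a)^-1 a P(a)).  So a product vanishes at a as soon
    as its left factor does, or its right factor vanishes on the whole sphere
    of a.

    Suppose that V_c(I) is the union of V1 = V_c(I1) and V2 = V_c(I2), that V1
    has spherical symmetry, and that neither set contains the other.  Pick a in
    V1 outside V2 and Q in I2 with Q(a) <> 0.  For every P in I1 the product
    Q * P vanishes on V2 because of Q, and on V1 because P vanishes on whole
    spheres there.  By the Nullstellensatz [vanishing_radical] it belongs to I;
    as Q does not, quasi primality puts P^s in I for every P in I1.  Now take b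
    in V2 outside V1.  All the P^s vanish at b, and by [conj_dichotomy] this
    forces the elements of I1 to have a common zero on the sphere of b, which
    then meets V1; by symmetry b lies in V1, a contradiction.

    The Nullstellensatz says that a completely prime right ideal J contains
    every F that vanishes on V_c(J).  The real polynomials in J form a prime
    ideal p, and a quaternionic polynomial vanishing at all complex zeros of p
    has its four real components in p [core_of_vanishing].  If all elements of
    J have their components in p, then the complex zeros of p lie in V_c(J), F
    vanishes there, and so F is in J.  Otherwise [conj_dichotomy], applied to J
    itself, yields G in J such that G^c is not in J while G^c * G' has its
    components in p for all G' in J.  At a complex zero a of p where
    w = G^c(a) <> 0, the product formula shows that w^-1 a w is in V_c(J), so
    that F vanishes there and G^c * F vanishes at a.  Hence G^c * F is in J,
    and complete primality gives F in J.

    What remains is commutative: a real polynomial outside a prime ideal p is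
    nonzero at some complex zero of p.  Since the complex field is uncountable
    and polynomials form a space of countable dimension, this has a short proof
    [avoiding_ideal_root]: in an ideal maximal among those avoiding the powers
    of f, each indeterminate is congruent to a constant. *)

Set Implicit Arguments.
Unset Strict Implicit.
Unset Printing Implicit Defensive.

Import GRing.Theory.
Local Open Scope classical_set_scope.
Local Open Scope ring_scope.

(** * Ideals avoiding the powers of an element *)

Section AvoidingIdeals.
Variable A : comNzRingType.
Implicit Types (a m : set A) (f x y : A).

Definition ideal a :=
  [/\ a 0, forall x y, a x -> a y -> a (x + y) & forall x y, a x -> a (x * y)].

Definition avoids_powers a f := forall k, ~ a (f ^+ k).

Lemma idealN a x : ideal a -> a x -> a (- x).
Proof. by case=> _ _ aM ax; rewrite -mulrN1; exact: aM. Qed.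

Lemma idealMl a x y : ideal a -> a y -> a (x * y).
Proof. by case=> _ _ aM ay; rewrite mulrC; apply: aM. Qed.

Lemma ideal_sum a (J : Type) (r : seq J) (P : pred J) (F : J -> A) :
  ideal a -> (forall j, P j -> a (F j)) -> a (\sum_(j <- r | P j) F j).
Proof. by case=> a0 aD _ aF; elim/big_ind: _ => //; exact: aD. Qed.

(** Zorn's lemma, in the form used below: enlarging the maximal ideal by x
    makes it meet the powers of f, so x is invertible up to such a power. *)
Lemma maximal_avoiding a f : ideal a -> avoids_powers a f ->
  exists m, [/\ ideal m, a `<=` m, avoids_powers m f &
    forall x, ~ m x -> exists y k, m (x * y - f ^+ k)].
Proof.
move=> ida avf; pose good X := [/\ ideal X, a `<=` X & avoids_powers X f].
(* The empty chain has an empty union, whence the guard X !=set0. *)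
have [F FP totF|m [Pm mmax]] := @Zorn_bigcup A [set X | X !=set0 -> good X].
  case=> x0 [X0 FX0 X0x0].
  have gX X x : F X -> X x -> good X by move=> FX Xx; apply: (FP X FX); exists x.
  have [[X00 _ _] aX0 _] := gX _ _ FX0 X0x0.
  split; [split| |].
  - by exists X0.
  - move=> x y [X FX Xx] [Y FY Yy].
    have [[_ XD _] _ _] := gX _ _ FX Xx; have [[_ YD _] _ _] := gX _ _ FY Yy.
    have [XY|YX] := totF _ _ FX FY.
      by exists Y => //; apply: YD => //; exact: XY.
    by exists X => //; apply: XD => //; exact: YX.
  - move=> x y [X FX Xx]; have [[_ _ XM] _ _] := gX _ _ FX Xx.
    by exists X => //; exact: XM.
  - by move=> x /aX0 X0x; exists X0.
  - by move=> k [X FX Xf]; have [_ _ /(_ k)] := gX _ _ FX Xf.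
have m_ne : m !=set0.
  apply: contrapT => m0; case: (ida) => a0 _ _.
  apply: (mmax a) => [|_]; last by split.
  split=> [x mx|am]; first by case: m0; exists x.
  by apply: m0; exists 0; exact: am.
have [idm am avm] := Pm m_ne; exists m; split=> // x nmx.
apply: contrapT => nox; case: (idm) => m0 mD mM.
apply: (mmax [set z | exists y, m (z - x * y)]).
  split=> [z mz|sub]; first by exists 0; rewrite mulr0 subr0.
  by apply/nmx/sub; exists 1; rewrite mulr1 subrr.
move=> _; split; [split| |].
- by exists 0; rewrite mulr0 subr0.
- move=> z t [y my] [u mu]; exists (y + u).
  by rewrite mulrDr opprD addrACA; exact: mD.
- move=> z t [y my]; exists (y * t).
  by rewrite mulrA -mulrBl; exact: mM.
- by move=> z /am mz; exists 0; rewrite mulr0 subr0.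
- move=> k [y my]; apply: nox; exists y, k.
  by rewrite -opprB; exact: idealN.
Qed.

Lemma maximal_avoiding_prime m f x y : ideal m -> avoids_powers m f ->
  (forall x, ~ m x -> exists y k, m (x * y - f ^+ k)) ->
  m (x * y) -> m x \/ m y.
Proof.
move=> idm avm mmax mxy; case: (idm) => _ mD mM.
apply: contrapT => /not_orP[/mmax[u [k mu]] /mmax[v [l mv]]].
apply: (avm (k + l)%N); rewrite exprD.
have -> : f ^+ k * f ^+ l = x * y * (u * v) - (x * u) * (y * v - f ^+ l)
                            - f ^+ l * (x * u - f ^+ k) by ring.
rewrite -addrA -opprD; apply: (mD); first exact: mM.
by apply: (idealN idm); apply: mD; exact: idealMl.
Qed.

End AvoidingIdeals.

(** * The Nullstellensatz over an uncountable closed field *)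

Lemma infinite_fiber (T : Type) (K : countType) (g : T -> K) :
  ~ countable [set: T] -> exists k, infinite_set (g @^-1` [set k]).
Proof.
move=> unc; apply: contrapT => /forallNP fin; apply: unc.
have -> : [set: T] = \bigcup_(k in [set: K]) (g @^-1` [set k]).
  by rewrite eqEsubset; split=> // x _; exists (g x).
apply: bigcup_countable => [|k _]; first exact: countableP.
by apply: finite_set_countable; apply: contrapT; exact: fin.
Qed.

Lemma uncountable_real (R : realType) : ~ countable [set: R].
Proof.
move/lebesgue_measure.countable_lebesgue_measure0.
have -> : [set: R] = [set` (Interval -oo%O +oo%O)] by rewrite set_interval.set_itvE.
by rewrite lebesgue_measure.lebesgue_measure_itv.
Qed.

(** Polynomials of bounded degree form a space of finite dimension. *)
Lemma linear_dependence (n d : nat) (C : fieldType) : exists N,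
  forall h : 'I_N -> {mpoly C[n]}, (forall i, msize (h i) <= d)%N ->
  exists2 l : 'I_N -> C, (exists i, l i != 0) & \sum_i l i *: h i = 0.
Proof.
pose D := #|{: 'X_{1..n < d}}|; exists D.+1 => h hd.
pose M := \matrix_(i < D.+1, j < D) (h i)@_(enum_val j : 'X_{1..n < d}).
have /rowV0Pn[v /sub_kermxP vM v0] : kermx M != 0.
  by rewrite -mxrank_eq0 mxrank_ker subn_eq0 -ltnNge ltnS rank_leq_col.
exists (v 0).
  by have /rV0Pn := v0.
apply/mpolyP => m; rewrite mcoeff0 raddf_sum /=.
have [md|dm] := ltnP (mdeg m) d; last first.
  rewrite big1 // => i _; rewrite mcoeffZ memN_msupp_eq0 ?mulr0 //.
  by apply: msize_mdeg_ge; apply: leq_trans (hd i) dm.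
have := congr1 (fun w : 'rV_D => w 0 (enum_rank (BMultinom md))) vM.
rewrite !mxE => vM0; rewrite -[RHS]vM0; apply: eq_bigr => i _.
by rewrite mcoeffZ mxE enum_rankK.
Qed.

Section Zeros.
Variables (C : closedFieldType) (n : nat).
Local Notation S := {mpoly C[n]}.
Implicit Types (a m : set S) (f g h : S).

(** Over a closed field q splits, so primality isolates a linear factor. *)
Lemma prime_poly_root m (x : S) (q : {poly C}) :
  ideal m -> ~ m 1 -> (forall x y, m (x * y) -> m x \/ m y) ->
  q != 0 -> m (map_poly (@mpolyC n C) q).[x] -> exists c : C, m (x - c%:MP).
Proof.
move=> idm m1 mP q0; have [r ->] := closed_field_poly_normal q.
rewrite map_polyZ /= hornerZ => /mP[mc|].
  case: m1; case: (idm) => _ _ mM; have := mM _ (lead_coef q)^-1%:MP mc.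
  by rewrite -mpolyCM mulfV ?lead_coef_eq0.
rewrite rmorph_prod /= horner_prod.
elim: r => [|c r IH]; first by rewrite big_nil.
rewrite big_cons => /mP[mc|//]; exists c.
by move: mc; rewrite map_polyXsubC /= hornerXsubC.
Qed.

(** If no 'X_i - c were in m, each would divide a power f^k modulo m, with a
    cofactor h_c.  Uncountably many c share the same k and the same bound on
    the degree of h_c, so finitely many of these h_c are linearly dependent.
    Clearing the denominators 'X_i - c in the dependence relation gives a
    nonzero univariate polynomial q with f^k q('X_i) in m, and a root of q
    contradicts the assumption on c. *)
Lemma avoiding_ideal_root m f i : ~ countable [set: C] -> ideal m ->
  avoids_powers m f ->
  (forall x, ~ m x -> exists y k, m (x * y - f ^+ k)) ->
  exists c : C, m ('X_i - c%:MP).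
Proof.
move=> unc idm avm mmax.
have mP x y := @maximal_avoiding_prime _ m f x y idm avm mmax.
have m1 : ~ m 1 by have := avm 0%N; rewrite expr0.
apply: contrapT => /forallNP noc.
have /choice[w hw] : forall c : C, exists w : S * nat,
    m (('X_i - c%:MP) * w.1 - f ^+ w.2).
  by move=> c; have [y [k myk]] := mmax _ (noc c); exists (y, k).
have [[k d] inf] := infinite_fiber (fun c => ((w c).2, msize (w c).1)) unc.
have [N dep] := linear_dependence n d C.
have [B Bsub leNB] := infinite_set_fset N inf.
pose c (i : 'I_N) : C := (enum_fset B)`_i.
have ltB (j : 'I_N) : (j < size (enum_fset B))%N by apply: leq_trans leNB.
have wc j : ((w (c j)).2, msize (w (c j)).1) = (k, d).
  exact: (Bsub (c j) (mem_nth _ (ltB j))).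
have inj_c : injective c.
  move=> j1 j2 /eqP; rewrite nth_uniq ?ltB ?fset_uniq // => /eqP; exact: val_inj.
have [|l [i0 li0] l0] := dep (fun j => (w (c j)).1).
  by move=> j; case: (wc j) => _ ->.
(* Lagrange interpolation: q takes at c i0 the value l i0 times a nonzero
   product. *)
pose q := \sum_j l j *: \prod_(j' | j' != j) ('X - (c j')%:P).
have q_neq0 : q != 0.
  apply: contra_neq li0 => q0; have := congr1 (fun p => p.[c i0]) q0.
  rewrite horner0 horner_sum (bigD1 i0) //= [X in _ + X]big1 ?addr0 => [|j ji0].
    rewrite hornerZ horner_prod => /eqP; rewrite mulf_eq0 => /orP[/eqP //|].
    rewrite prodf_seq_eq0 => /hasP[j _ /andP[ji0]].
    by rewrite hornerXsubC subr_eq0 (inj_eq inj_c) eq_sym (negPf ji0).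
  rewrite hornerZ horner_prod (bigD1 i0) 1?eq_sym //=.
  by rewrite hornerXsubC subrr mul0r mulr0.
suff mq : m (map_poly (@mpolyC n C) q).['X_i].
  by have [c' mc'] := prime_poly_root idm m1 mP q_neq0 mq; case: (noc c').
have [] // : m (f ^+ k) \/ m (map_poly (@mpolyC n C) q).['X_i]; last first.
  by move/avm.
apply: mP.
pose x : S := 'X_i; pose F j := \prod_(j' | j' != j) (x - (c j')%:MP).
have -> : (map_poly (@mpolyC n C) q).['X_i] = \sum_j (l j)%:MP * F j.
  rewrite raddf_sum /= horner_sum; apply: eq_bigr => j _.
  rewrite map_polyZ hornerZ /= rmorph_prod /= horner_prod; congr (_ * _).
  by apply: eq_bigr => j' _; rewrite map_polyXsubC /= hornerXsubC.
have -> : f ^+ k * (\sum_j (l j)%:MP * F j) =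
    - \sum_j ((x - (c j)%:MP) * (w (c j)).1 - f ^+ k) * ((l j)%:MP * F j).
  apply/eqP; rewrite -addr_eq0 mulr_sumr -big_split /=.
  pose G := \prod_j (x - (c j)%:MP).
  rewrite (eq_bigr (fun j => G * (l j *: (w (c j)).1))) => [|j _].
    by rewrite -mulr_sumr l0 mulr0.
  rewrite /G (bigD1 j) //= -/(F j) -mul_mpolyC; ring.
apply: (idealN idm); apply: (ideal_sum _ idm) => j _.
by case: (idm) => _ _; apply; have := hw (c j); case: (wc j) => -> _.
Qed.

(** Modulo the maximal ideal m, every polynomial is congruent to its value at
    the point z whose coordinates are the constants of [avoiding_ideal_root];
    so z is a zero of m, while f, being outside m, does not vanish there. *)
Lemma nullstellensatz_avoiding a f : ~ countable [set: C] -> ideal a ->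
  avoids_powers a f ->
  exists z : 'I_n -> C, (forall g, a g -> g.@[z] = 0) /\ f.@[z] != 0.
Proof.
move=> unc ida avf.
have [m [idm am avm mmax]] := maximal_avoiding ida avf.
have /choice[z mz] := fun i => avoiding_ideal_root i unc idm avm mmax.
case: (idm) => m0 mD mM.
have mE g : m (g - g.@[z]%:MP).
  have mX (t : 'X_{1..n}) : m ('X_[t] - ('X_[t].@[z])%:MP).
    rewrite mpolyXE_id (rmorph_prod (meval z)) (rmorph_prod (@mpolyC n C)) /=.
    have goodM p p' r r' : m (p - p') -> m (r - r') -> m (p * r - p' * r').
      move=> mp mr; have -> : p * r - p' * r' = (p - p') * r + p' * (r - r') by ring.
      by apply: mD; [exact: mM | exact: idealMl].
    elim/big_rec2: _ => [|i p p' _ mp]; first by rewrite subrr.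
    apply: (goodM) => //; rewrite !rmorphXn /= mevalXU.
    by elim: (t i) => [|k IH]; rewrite ?expr0 ?subrr // !exprS; apply: goodM.
  rewrite [in X in m X](mpolyE g) (raddf_sum (meval z))
    (raddf_sum (@mpolyC n C)) -sumrB /=.
  apply: ideal_sum => // t _.
  rewrite mevalZ mpolyCM -mul_mpolyC -mulrBr; exact: idealMl.
have mC (c : C) : m c%:MP -> c = 0.
  move=> mc; apply/eqP/negPn/negP => c0; apply: (avm 0%N).
  by rewrite expr0 -[1]/(1%:MP) -(mulfV c0) mpolyCM; exact: mM.
exists z; split=> [g /am mg|].
  apply: mC; have := mD _ _ mg (idealN idm (mE g)).
  by rewrite opprB addrC subrK.
apply/eqP => f0; apply: (avm 1%N); rewrite expr1.
by have := mE f; rewrite f0 mpolyC0 subr0.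
Qed.
End Zeros.

(** * Complex zeros of a prime ideal of real polynomials *)

Lemma gauss_mul (S : comNzRingType) (j a b c d : S) : j * j = - 1 ->
  (a + j * b) * (c + j * d) = a * c - b * d + j * (a * d + b * c).
Proof.
move=> jj; have -> : (a + j * b) * (c + j * d) =
  a * c + (j * j) * (b * d) + j * (a * d + b * c) by ring.
by rewrite jj mulN1r.
Qed.

Section ComplexPoints.
Variables (R : realType) (n : nat).
Local Notation toC := (map_mpoly (real_complex R)).
Implicit Types (p : set {mpoly R[n]}) (f g u v : {mpoly R[n]}).

Lemma uncountable_complex : ~ countable [set: R[i]].
Proof.
move=> cC; apply: (@uncountable_real R).
have -> : [set: R] = @Re R @` [set: R[i]].
  by rewrite eqEsubset; split=> // x _; exists x%:C%C.
exact: sub_countable (card_image_le _ _) cC.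
Qed.

Let im : {mpoly R[i][n]} := ('i%C)%:MP.

Let imM : im * im = - 1.
Proof. by rewrite /im -mpolyCM -expr2 sqr_i mpolyCN mpolyC1. Qed.

Lemma Re_coef u v t : complex.Re (toC u + im * toC v)@_t = u@_t.
Proof.
rewrite mcoeffD /im mcoeffCM.
rewrite [X in complex.Re (X + _)]mcoeff_map_mpoly.
rewrite [X in complex.Re (_ + _ * X)]mcoeff_map_mpoly.
by move: u@_t v@_t => x y; rewrite /= mul0r mul1r subr0 addr0.
Qed.

Lemma mpoly_complexE (h : {mpoly R[i][n]}) :
  exists u v, h = toC u + im * toC v.
Proof.
elim/mpolyind: h => [|c t h _ _ [u [v ->]]].
  by exists 0, 0; rewrite !raddf0 mulr0 addr0.
exists ((complex.Re c) *: 'X_[t] + u), ((complex.Im c) *: 'X_[t] + v).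
rewrite !raddfD /= !map_mpolyZ /= !map_mpolyX mulrDr addrACA; congr (_ + _).
rewrite {1}[c]complexE -!mul_mpolyC mpolyCD mpolyCM mulrDl mulrA //.
Qed.

(** The Nullstellensatz is applied to the complex span p + i p of p, which
    avoids the powers of f because the real part of an element of p + i p is
    in p. *)
Lemma complex_zero_of_prime p f : ideal p ->
  (forall x y, p (x * y) -> p x \/ p y) -> ~ p f ->
  exists z : 'I_n -> R[i],
    (forall g, p g -> (toC g).@[z] = 0) /\ (toC f).@[z] != 0.
Proof.
move=> idp pP npf; case: (idp) => p0 pD pM.
have pf k : ~ p (f ^+ k).
  elim: k => [|k IH]; last by rewrite exprS => /pP[].
  by move=> p1; apply: npf; rewrite -[f]mul1r; exact: (pM 1 f).
pose a := [set h | exists u v, [/\ p u, p v & h = toC u + im * toC v]].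
have [||z [az fz]] := @nullstellensatz_avoiding _ _ a (toC f) uncountable_complex.
- split.
  + by exists 0, 0; rewrite !raddf0 mulr0 addr0.
  + move=> _ _ [u [v [pu pv ->]]] [u' [v' [pu' pv' ->]]].
    exists (u + u'), (v + v'); split; [exact: pD|exact: pD|].
    by rewrite !raddfD /= mulrDr addrACA.
  + move=> _ y [u [v [pu pv ->]]]; have [b [c ->]] := mpoly_complexE y.
    exists (u * b - v * c), (u * c + v * b); split.
    * by apply: pD; [|apply: (idealN idp)]; exact: pM.
    * by apply: pD; exact: pM.
    * rewrite raddfB raddfD /= !rmorphM /=.
      exact: gauss_mul imM.
- move=> k [u [v [pu pv]]]; rewrite -rmorphXn /= => e; apply: (pf k).
  rewrite (_ : f ^+ k = u) //; apply/mpolyP => t; apply: complexI.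
  by have := congr1 (fun h => (complex.Re h@_t)%:C%C) e; rewrite Re_coef
    mcoeff_map_mpoly.
exists z; split=> // g pg; apply: az; exists g, 0.
by split=> //; rewrite raddf0 mulr0 addr0.
Qed.
End ComplexPoints.

(** * Evaluation at a point with commuting coordinates *)

(** Computations with inverses are carried out in an arbitrary ring, where the
    explicit formulas for quaternions cannot unfold. *)
Lemma exprV_conj (U : unitRingType) (w x : U) k : w \is a GRing.unit ->
  (w^-1 * x * w) ^+ k = w^-1 * x ^+ k * w.
Proof.
move=> w0; elim: k => [|k IH]; first by rewrite !expr0 mulr1 mulVr.
by rewrite !exprS IH !mulrA mulrK.
Qed.

Lemma prod_conj (U : unitRingType) (J : Type) (r : seq J) (p : pred J)
    (F : J -> U) (w : U) : w \is a GRing.unit ->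
  \prod_(j <- r | p j) (w^-1 * F j * w) = w^-1 * (\prod_(j <- r | p j) F j) * w.
Proof.
move=> w0; elim/big_rec2: _ => [|i x y _ ->]; first by rewrite mulr1 mulVr.
by rewrite !mulrA mulrK.
Qed.

Lemma mulr_conj (U : unitRingType) (w x y : U) : w \is a GRing.unit ->
  w * (w^-1 * x * w * y) = x * w * y.
Proof. by move=> w0; rewrite -!mulrA mulVKr. Qed.

Section SliceEvaluation.
Variables (R : realType) (n : nat).
Local Notation H := (quaternion R).
Implicit Types (P Q F G : {mpoly H[n]}) (a b : 'I_n -> H) (w : H).

Definition commuting a := forall i j, a i * a j = a j * a i.

Definition conj_point w a : 'I_n -> H := fun i => w^-1 * a i * w.

Lemma slice_evalD P Q a : slice_eval (P + Q) a = slice_eval P a + slice_eval Q a.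
Proof.
pose k := maxn (msize (P + Q)) (maxn (msize P) (msize Q)).
rewrite !(@slice_evalE _ _ _ _ k) ?leq_max ?leqnn ?orbT // -big_split.
by apply: eq_bigr => m _; rewrite mcoeffD mulrDr.
Qed.

Lemma slice_eval0 a : slice_eval 0 a = 0.
Proof. by rewrite /slice_eval msupp0 big_nil. Qed.

Lemma slice_eval_sum (J : Type) (r : seq J) (p : pred J) (F : J -> {mpoly H[n]}) a :
  slice_eval (\sum_(j <- r | p j) F j) a = \sum_(j <- r | p j) slice_eval (F j) a.
Proof.
apply: (big_morph (fun P => slice_eval P a)) => [P Q|].
  exact: slice_evalD.
exact: slice_eval0.
Qed.

Lemma monomialD a (l m : 'X_{1..n}) : commuting a ->
  \prod_(i < n) a i ^+ (l + m)%MM i =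
  (\prod_(i < n) a i ^+ l i) * \prod_(i < n) a i ^+ m i.
Proof.
move=> ca; rewrite -prodrM_comm => [|i j _ _]; last first.
  by apply: commrX; apply/commr_sym/commrX/ca.
by apply: eq_bigr => i _; rewrite mnmDE exprD.
Qed.

Lemma slice_evalM P Q a : commuting a -> slice_eval (P * Q) a =
  \sum_(m <- msupp Q) (\prod_(i < n) a i ^+ m i) * slice_eval P a * Q@_m.
Proof.
move=> ca; rewrite [in LHS](mpolyE Q) mulr_sumr slice_eval_sum /=.
apply: eq_bigr => m _; rewrite {1}(mpolyE P) mulr_suml.
rewrite slice_eval_sum [in RHS]/slice_eval mulr_sumr mulr_suml.
apply: eq_bigr => l _.
by rewrite slice_mul_monomial slice_eval_monomial addmC monomialD // !mulrA.
Qed.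

Lemma slice_evalM0 P Q a : commuting a ->
  slice_eval P a = 0 -> slice_eval (P * Q) a = 0.
Proof.
by move=> ca Pa; rewrite slice_evalM // big1 // => m _; rewrite Pa mulr0 mul0r.
Qed.

Lemma monomial_conj a w (m : 'X_{1..n}) : w != 0 ->
  \prod_(i < n) conj_point w a i ^+ m i = w^-1 * (\prod_(i < n) a i ^+ m i) * w.
Proof.
by move=> w0; rewrite -prod_conj //; apply: eq_bigr => i _; exact: exprV_conj.
Qed.

(** Here P(a) = w sits between a^m and the coefficients of Q, and a^m w equals
    w (w^-1 a w)^m. *)
Lemma slice_evalM_conj P Q a : commuting a -> slice_eval P a != 0 ->
  slice_eval (P * Q) a =
  slice_eval P a * slice_eval Q (conj_point (slice_eval P a) a).
Proof.
move=> ca w0; rewrite slice_evalM // {2}/slice_eval mulr_sumr.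
by apply: eq_bigr => m _; rewrite monomial_conj //; exact/esym/mulr_conj.
Qed.

Lemma slice_evalC w a : slice_eval w%:MP a = w.
Proof.
rewrite -[w%:MP]mulr1 mul_mpolyC -mpolyX0 slice_eval_monomial big1 ?mul1r //.
by move=> i _; rewrite mnm0E expr0.
Qed.

End SliceEvaluation.

(** * Real components of quaternions and of polynomials *)

Section QuaternionParts.
Variable R : realType.
Local Notation H := (quaternion R).
Implicit Types (x y : H) (s t : R).

Definition qi : H := Quat 0 1 0 0.
Definition qj : H := Quat 0 0 1 0.
Definition qk : H := Quat 0 0 0 1.

Fact quat_real_is_zmod_morphism : zmod_morphism (@quat_real R).
Proof. by move=> s t; apply: quatP; rewrite /= ?subr0. Qed.
HB.instance Definition _ :=
  GRing.isZmodMorphism.Build R H (@quat_real R) quat_real_is_zmod_morphism.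

Lemma quat_realM_l s x : quat_real s * x = Quat (s * q0 x) (s * q1 x) (s * q2 x) (s * q3 x).
Proof. by apply: quatP; rewrite /= !mul0r ?subr0 ?addr0. Qed.

Lemma quat_realC s x : quat_real s * x = x * quat_real s.
Proof.
rewrite quat_realM_l; apply: quatP; rewrite /= !mulr0 ?subr0 ?addr0 ?add0r mulrC //.
Qed.

Fact quat_real_is_monoid_morphism : monoid_morphism (@quat_real R).
Proof. by split=> // s t; rewrite quat_realM_l; apply: quatP; rewrite /= ?mulr0. Qed.
HB.instance Definition _ :=
  GRing.isMonoidMorphism.Build R H (@quat_real R) quat_real_is_monoid_morphism.

Fact q0_is_zmod_morphism : zmod_morphism (@q0 R).
Proof. by []. Qed.
HB.instance Definition _ :=
  GRing.isZmodMorphism.Build H R (@q0 R) q0_is_zmod_morphism.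

Lemma quat_conjM x y : quat_conj (x * y) = quat_conj y * quat_conj x.
Proof. by apply: quatP => /=; ring. Qed.

Lemma quat_conjK x : quat_conj (quat_conj x) = x.
Proof. by apply: quatP; rewrite /= ?opprK. Qed.

Lemma quat_addJ x : x + quat_conj x = quat_real (q0 x) + quat_real (q0 x).
Proof. by apply: quatP; rewrite /= ?subrr ?addr0. Qed.

Lemma quat_basisE x :
  x = quat_real (q0 x) + quat_real (q0 (x * - qi)) * qi
    + quat_real (q0 (x * - qj)) * qj + quat_real (q0 (x * - qk)) * qk.
Proof.
by apply: quatP; rewrite /= !(mul0r, mulr0, mul1r, mulr1, mulN1r, mulrN1, oppr0,
  addr0, add0r, subr0, sub0r, opprK, mulrN, mulNr).
Qed.

(** The two averaging formulas recover the real part of x from products of x,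
    respectively of its conjugates, by the basis 1, i, j, k. *)
Lemma quat_realE4 x :
  quat_real (q0 x) *+ 4 = x + qi * x * - qi + qj * x * - qj + qk * x * - qk.
Proof.
by apply: quatP; rewrite /= !(mul0r, mulr0, mul1r, mulr1, mulN1r, mulrN1, oppr0,
  addr0, add0r, subr0, sub0r, opprK, mulrN, mulNr); ring.
Qed.

Lemma quat_real_conjE4 x :
  quat_real (q0 x) *+ 4 = quat_conj x + quat_conj (x * qi) * qi
    + quat_conj (x * qj) * qj + quat_conj (x * qk) * qk.
Proof.
by apply: quatP; rewrite /= !(mul0r, mulr0, mul1r, mulr1, mulN1r, mulrN1, oppr0,
  addr0, add0r, subr0, sub0r, opprK, mulrN, mulNr); ring.
Qed.

End QuaternionParts.

Lemma mulDD_polar (S : pzRingType) (x y z t : S) :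
  (x + y) * (z + t) = x * z + y * t + (x * t + y * z).
Proof.
rewrite mulrDl !mulrDr -!addrA; congr (_ + _).
by rewrite [RHS]addrCA; congr (_ + _); exact: addrC.
Qed.

Lemma addr_eq_subr (S : zmodType) (x y z : S) : z = x + y -> z - x = y.
Proof. by move->; rewrite addrC addKr. Qed.

Section PolynomialParts.
Variables (R : realType) (n : nat).
Local Notation H := (quaternion R).
Local Notation A := {mpoly H[n]}.
Local Notation qi := (qi R).
Local Notation qj := (qj R).
Local Notation qk := (qk R).
Implicit Types (P Q F G : A) (I J T : set A) (f g : {mpoly R[n]}) (w : H).

Definition real_poly f : A := map_mpoly (@quat_real R) f.
Definition real_part P : {mpoly R[n]} := map_mpoly (@q0 R) P.

HB.instance Definition _ :=
  GRing.RMorphism.copy real_poly (map_mpoly (@quat_real R)).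
HB.instance Definition _ :=
  GRing.Additive.copy real_part (map_mpoly (@q0 R)).

Lemma mcoeff_real_poly f m : (real_poly f)@_m = quat_real f@_m.
Proof. exact: mcoeff_map_mpoly. Qed.

Lemma mcoeff_real_part P m : (real_part P)@_m = q0 P@_m.
Proof. exact: mcoeff_map_mpoly. Qed.

Lemma mcoeff_real P m : (real_poly (real_part P))@_m = quat_real (q0 P@_m).
Proof. exact: etrans (mcoeff_real_poly _ _) (congr1 _ (mcoeff_real_part _ _)). Qed.

Lemma mcoeff_reg_conj P m : (reg_conj P)@_m = quat_conj P@_m.
Proof. exact: mcoeff_map_mpoly. Qed.

Lemma mcoeffMC P w m : (P * w%:MP)@_m = P@_m * w.
Proof.
rewrite [in LHS](mpolyE P) mulr_suml [in RHS](mpolyE P) !raddf_sum mulr_suml.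
apply: eq_bigr => l _ /=.
by rewrite -[w%:MP]mulr1 mul_mpolyC -mpolyX0 slice_mul_monomial addm0 !mcoeffZ
  mcoeffX; case: eqP; rewrite ?mulr1 ?mulr0 ?mul0r.
Qed.

(** The convolution with the two exponents exchanged, for comparing products
    taken in opposite orders. *)
Lemma mcoeffM_swap P Q m : (P * Q)@_m =
  \sum_(k : 'X_{1..n < (mdeg m).+1, (mdeg m).+1} | m == (k.1 + k.2)%MM)
    P@_k.2 * Q@_k.1.
Proof.
rewrite mcoeffM.
pose swap (k : 'X_{1..n < (mdeg m).+1, (mdeg m).+1}) := (k.2, k.1).
have swapI : injective swap by move=> [? ?] [? ?] [-> ->].
rewrite [LHS](reindex_inj swapI) /swap /=.
by apply: eq_bigl => k; rewrite addmC.
Qed.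

Lemma real_polyC f P : real_poly f * P = P * real_poly f.
Proof.
apply/mpolyP => m; rewrite mcoeffM_swap mcoeffM; apply: eq_bigr => k _.
by rewrite mcoeff_real_poly quat_realC.
Qed.

Lemma reg_conjM P Q : reg_conj (P * Q) = reg_conj Q * reg_conj P.
Proof.
apply/mpolyP => m; rewrite mcoeff_reg_conj mcoeffM mcoeffM_swap raddf_sum /=.
by apply: eq_bigr => k _; rewrite !mcoeff_reg_conj quat_conjM.
Qed.

Lemma reg_conjD P Q : reg_conj (P + Q) = reg_conj P + reg_conj Q.
Proof. exact: raddfD. Qed.

Lemma reg_conjK P : reg_conj (reg_conj P) = P.
Proof. by apply/mpolyP => m; rewrite !mcoeff_reg_conj quat_conjK. Qed.

Lemma add_reg_conj P :
  P + reg_conj P = real_poly (real_part P) + real_poly (real_part P).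
Proof.
apply/mpolyP => m; rewrite [LHS]mcoeffD [RHS]mcoeffD.
rewrite [in LHS]mcoeff_reg_conj [in RHS]mcoeff_real.
exact: quat_addJ.
Qed.

Lemma mcoeffD4 P Q F G m : (P + Q + F + G)@_m = P@_m + Q@_m + F@_m + G@_m.
Proof. by rewrite 3![in LHS]mcoeffD. Qed.

Lemma basisE P : P = real_poly (real_part P)
  + real_poly (real_part (P * (- qi)%:MP)) * qi%:MP
  + real_poly (real_part (P * (- qj)%:MP)) * qj%:MP
  + real_poly (real_part (P * (- qk)%:MP)) * qk%:MP.
Proof.
have E w m : (real_poly (real_part (P * (- w)%:MP)) * w%:MP)@_m =
    quat_real (q0 (P@_m * - w)) * w.
  by rewrite mcoeffMC mcoeff_real mcoeffMC.
apply/mpolyP => m; rewrite [RHS]mcoeffD4 [LHS]quat_basisE.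
by congr (_ + _ + _ + _); rewrite ?E ?mcoeff_real.
Qed.

Lemma real_partE4 P : real_poly (real_part P) *+ 4 = P
  + qi%:MP * P * (- qi)%:MP + qj%:MP * P * (- qj)%:MP + qk%:MP * P * (- qk)%:MP.
Proof.
have E w m : (w%:MP * P * (- w)%:MP)@_m = w * P@_m * - w.
  by rewrite mcoeffMC mcoeffCM.
apply/mpolyP => m; rewrite [RHS]mcoeffD4 [LHS]mcoeffMn [in LHS]mcoeff_real.
by rewrite [LHS]quat_realE4; congr (_ + _ + _ + _); rewrite E.
Qed.

Lemma real_part_conjE4 P : real_poly (real_part P) *+ 4 = reg_conj P
  + reg_conj (P * qi%:MP) * qi%:MP + reg_conj (P * qj%:MP) * qj%:MP
  + reg_conj (P * qk%:MP) * qk%:MP.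
Proof.
have E w m : (reg_conj (P * w%:MP) * w%:MP)@_m = quat_conj (P@_m * w) * w.
  by rewrite mcoeffMC mcoeff_reg_conj mcoeffMC.
apply/mpolyP => m; rewrite [RHS]mcoeffD4 [LHS]mcoeffMn [in LHS]mcoeff_real.
by rewrite [LHS]quat_real_conjE4; congr (_ + _ + _ + _); rewrite ?E ?mcoeff_reg_conj.
Qed.

Lemma right_idealB J P Q : right_ideal J -> J P -> J Q -> J (P - Q).
Proof.
by case=> _ JD JM JP JQ; apply: JD => //; rewrite -mulrN1; exact: JM.
Qed.

Lemma right_ideal_divn J P k : right_ideal J -> J (P *+ k.+1) -> J P.
Proof.
move=> [_ _ JM] JP; pose s : R := k.+1%:R^-1.
have s1 : quat_real s *+ k.+1 = 1.
  by rewrite -raddfMn /= -[s *+ _]mulr_natl divff ?rmorph1 // Num.Theory.pnatr_eq0.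
have := JM _ (quat_real s)%:MP JP.
by rewrite mulrnAl -mulrnAr -mpolyCMn s1 mpolyC1 mulr1.
Qed.

(** The polynomials whose four real components all lie in J: the real part of
    P w runs through the real combinations of these components.  For a right
    ideal J this is the extension to quaternionic polynomials of the ideal of
    real polynomials in J. *)
Definition core J : set A :=
  [set P | forall w, J (real_poly (real_part (P * w%:MP)))].

Lemma core_sub J P : right_ideal J -> core J P -> J P.
Proof.
move=> [_ JD JM] cP; rewrite (basisE P).
have c1 := cP 1; rewrite mpolyC1 mulr1 in c1.
by do !apply: (JD) => //; apply: (JM); exact: cP.
Qed.

Lemma reg_conj_polar G P : reg_conj (G + P) * (G + P) =
  reg_conj G * G + reg_conj P * P + (reg_conj G * P + reg_conj P * G).
Proof. by rewrite [in LHS]reg_conjD; exact: mulDD_polar. Qed.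

(** Up to inverting real polynomials and extending scalars to the complex
    numbers, quaternionic polynomials become 2 x 2 matrices, G^c is the adjugate
    of G and G^s its determinant.  A right ideal T of matrices whose
    determinants all vanish is zero, or consists of the matrices with a given
    line as image; in the latter case adj(G) G' = 0 for all G, G' in T.  In the
    present terms, polarizing G^s puts the trace of G^c * G' * w in J for all w,
    hence all real components of G^c * G'; and if all the conjugates G^c were in
    J, averaging them would put the components of G in J. *)
Lemma conj_dichotomy T J : right_ideal T -> right_ideal J ->
  (forall G, T G -> J (symmetrization G)) ->
  (forall G, T G -> core J G) \/
  exists G, [/\ T G, ~ J (reg_conj G) & forall G', T G' -> core J (reg_conj G * G')].
Proof.
move=> rT rJ TJ; have [_ TD TM] := rT; have [_ JD JM] := rJ.
have {}TJ G : T G -> J (reg_conj G * G).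
  by move=> TG; rewrite -symmetrizationC; exact: TJ.
have polar G G' : T G -> T G' -> core J (reg_conj G * G').
  move=> TG TG' w; pose P := G' * w%:MP; have TP : T P by exact: TM.
  have JGP : J (reg_conj G * P + reg_conj P * G).
    rewrite -(addr_eq_subr (reg_conj_polar G P)).
    exact: right_idealB rJ (TJ _ (TD _ _ TG TP)) (JD _ _ (TJ _ TG) (TJ _ TP)).
  apply: (@right_ideal_divn _ _ 1) => //; rewrite mulr2n -add_reg_conj.
  by rewrite -mulrA reg_conjM reg_conjK.
have [|nex] := pselect (exists2 G, T G & ~ J (reg_conj G)).
  by move=> [G TG nJG]; right; exists G; split=> // G'; exact: polar.
left=> G TG w; apply: (@right_ideal_divn _ _ 3) => //; rewrite real_part_conjE4.
have JG P : T P -> J (reg_conj P).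
  by move=> TP; apply: contrapT => nJ; apply: nex; exists P.
have TGw : T (G * w%:MP) by exact: TM.
by do ![apply: (JD)]; try apply: (JM); apply: JG; try apply: (TM).
Qed.

End PolynomialParts.

(** * Points in a slice, and complex points *)

Lemma conj_affine (U : unitRingType) (w s t x : U) : w \is a GRing.unit ->
  GRing.comm w s -> GRing.comm w t ->
  w^-1 * (s + t * x) * w = s + t * (w^-1 * x * w).
Proof.
move=> w0 ws wt; apply: (mulrI w0).
by rewrite -mulrA mulVKr // mulrDl mulrDr [w * (t * _)]mulrA ws wt -!mulrA mulVKr.
Qed.

Section SlicePoints.
Variables (R : realType) (n : nat).
Local Notation H := (quaternion R).
Local Notation A := {mpoly H[n]}.
Local Notation toC := (map_mpoly (real_complex R)).
Implicit Types (P Q F G : A) (I J T : set A) (f g : {mpoly R[n]}) (w : H).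
Implicit Types (a b : 'I_n -> H).

Definition in_slice a := exists2 K : H, imag_units K & forall i, slice K (a i).

Lemma czero_setE I a : czero_set I a <-> zero_set I a /\ in_slice a.
Proof.
by split=> [[Ia [K iK aK]]|[Ia [K iK aK]]]; split=> //; exists K.
Qed.

Lemma in_slice_commuting a : in_slice a -> commuting a.
Proof.
move=> [K _ aK] i j.
have [s [t ->]] := aK i; have [s' [t' ->]] := aK j.
have cr r (x : H) : GRing.comm x (quat_real r) by exact/esym/quat_realC.
have cK : GRing.comm K (quat_real s' + quat_real t' * K).
  exact: commrD (cr _ _) (commrM (cr _ _) (commr_refl K)).
exact/commr_sym/(commrD (cr _ _) (commrM (cr _ _) (commr_sym cK))).
Qed.

Lemma in_slice_conj w a : w != 0 -> in_slice a -> in_slice (conj_point w a).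
Proof.
move=> w0 [K K2 aK]; exists (w^-1 * K * w).
  rewrite /imag_units /= exprV_conj //; rewrite /imag_units /= in K2.
  by rewrite K2 mulrN1 mulNr mulVr.
move=> i; have [s [t ai]] := aK i; exists s, t; rewrite /conj_point ai.
by apply: conj_affine => //; exact/esym/quat_realC.
Qed.

Lemma right_ideal_point a : in_slice a ->
  right_ideal [set P : A | slice_eval P a = 0].
Proof.
move=> /in_slice_commuting ca; split=> /= [|P Q Pa Qa|P Q Pa].
- exact: slice_eval0.
- by rewrite slice_evalD Pa Qa addr0.
- exact: slice_evalM0.
Qed.

(** The complex field is embedded as the slice of i. *)
Definition complex_quat (z : R[i]) : H := Quat (complex.Re z) (complex.Im z) 0 0.

Fact complex_quat_is_zmod_morphism : zmod_morphism complex_quat.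
Proof. by move=> [x y] [x' y']; apply: quatP; rewrite /= ?subr0. Qed.
HB.instance Definition _ := GRing.isZmodMorphism.Build R[i] H complex_quat
  complex_quat_is_zmod_morphism.

Fact complex_quat_is_monoid_morphism : monoid_morphism complex_quat.
Proof.
split=> // -[x y] [x' y']; apply: quatP;
  by rewrite /= !(mul0r, mulr0) ?subr0 ?addr0.
Qed.
HB.instance Definition _ := GRing.isMonoidMorphism.Build R[i] H complex_quat
  complex_quat_is_monoid_morphism.

Definition complex_point (z : 'I_n -> R[i]) : 'I_n -> H := fun i => complex_quat (z i).

Lemma in_slice_complex z : in_slice (complex_point z).
Proof.
exists (qi R).
  by apply: quatP; rewrite /= !(mul0r, mulr0, mulr1) ?subr0 ?addr0 ?sub0r ?oppr0.
move=> i; exists (complex.Re (z i)), (complex.Im (z i)).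
apply: quatP; rewrite /= !(mul0r, mulr0, mulr1);
  by rewrite ?subr0 ?addr0 ?add0r.
Qed.

Lemma slice_eval_real f z :
  slice_eval (real_poly f) (complex_point z) = complex_quat (toC f).@[z].
Proof.
elim/mpolyind: f => [|c m f _ _ IH].
  by rewrite !raddf0 slice_eval0.
have -> : real_poly (c *: 'X_[m] + f) = quat_real c *: 'X_[m] + real_poly f.
  by rewrite [LHS]raddfD /= /real_poly map_mpolyZ map_mpolyX.
have -> : toC (c *: 'X_[m] + f) = (c%:C)%C *: 'X_[m] + toC f.
  by rewrite [LHS]raddfD /= map_mpolyZ map_mpolyX.
rewrite slice_evalD IH mevalD raddfD; congr (_ + _).
rewrite slice_eval_monomial mevalZ mevalX.
rewrite [RHS](rmorphM complex_quat) (rmorph_prod complex_quat).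
rewrite -[LHS]quat_realC; congr (_ * _); apply: eq_bigr => i _.
by rewrite (rmorphXn complex_quat).
Qed.

Lemma ideal_real_trace J : right_ideal J -> ideal [set f | J (real_poly f)].
Proof.
move=> [J0 JD JM]; split=> /= [|f g Jf Jg|f g Jf].
- by rewrite (raddf0 (@real_poly R n)).
- by rewrite (raddfD (@real_poly R n)); exact: JD Jf Jg.
- by rewrite (rmorphM (@real_poly R n)); exact: (JM _ _ Jf).
Qed.

Lemma core_eval0 J P z : right_ideal J -> core J P ->
  (forall f, J (real_poly f) -> (toC f).@[z] = 0) ->
  slice_eval P (complex_point z) = 0.
Proof.
move=> rJ cP Jz; have ca := in_slice_commuting (in_slice_complex z).
have z0 w : slice_eval (real_poly (real_part (P * w%:MP))) (complex_point z) = 0.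
  by rewrite slice_eval_real Jz ?raddf0 //; exact: cP.
have z1 : slice_eval (real_poly (real_part P)) (complex_point z) = 0.
  by have := z0 1; rewrite mpolyC1 mulr1.
rewrite (basisE P) !slice_evalD z1 !(slice_evalM0 _ ca (z0 _)).
by rewrite !addr0.
Qed.
End SlicePoints.

(** * The Nullstellensatz for completely prime right ideals *)

Section SliceNullstellensatz.
Variables (R : realType) (n : nat).
Local Notation H := (quaternion R).
Local Notation A := {mpoly H[n]}.
Local Notation toC := (map_mpoly (real_complex R)).
Implicit Types (P Q F G : A) (I J T : set A) (f g : {mpoly R[n]}) (w : H).
Implicit Types (a b : 'I_n -> H) (z : 'I_n -> R[i]).

(** Real polynomials are central, so they always satisfy the stability
    condition of complete primality. *)
Lemma real_trace_prime J f g : completely_prime J ->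
  J (real_poly (f * g)) -> J (real_poly f) \/ J (real_poly g).
Proof.
move=> [[_ _ JM] Jp]; rewrite (rmorphM (@real_poly R n)) => /Jp; apply.
by move=> F JF; rewrite real_polyC; exact: JM.
Qed.

Lemma conjcM : {morph (@conjc R) : x y / x * y}.
Proof. exact: rmorphM. Qed.

Definition conj_complex z : 'I_n -> R[i] := fun i => (z i)^*%C.

Lemma meval_conj f z : (toC f).@[conj_complex z] = ((toC f).@[z])^*%C.
Proof.
elim/mpolyind: f => [|c m f _ _ IH].
  by rewrite raddf0 !meval0 conjc0.
have -> : toC (c *: 'X_[m] + f) = (c%:C)%C *: 'X_[m] + toC f.
  by rewrite [LHS]raddfD /= map_mpolyZ map_mpolyX.
rewrite !mevalD IH (raddfD (@conjc R)); congr (_ + _).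
rewrite !mevalZ !mevalX; apply: (etrans _ (esym (conjcM _ _))).
rewrite conjc_real; congr (_ * _).
elim/big_rec2: _ => [|i x y _ ->]; first by rewrite conjc1.
apply: (etrans _ (esym (conjcM _ _))); congr (_ * _).
rewrite /conj_complex; elim: (m i) => [|k IHk]; first by rewrite expr0 conjc1.
by rewrite !exprS IHk; exact: esym (conjcM _ _).
Qed.

Lemma qi_neq0 : qi R != 0. Proof. by apply/eqP => -[/eqP]; rewrite oner_eq0. Qed.
Lemma qj_neq0 : qj R != 0. Proof. by apply/eqP => -[/eqP]; rewrite oner_eq0. Qed.
Lemma qk_neq0 : qk R != 0. Proof. by apply/eqP => -[/eqP]; rewrite oner_eq0. Qed.

Lemma conj_pointP w a b : w != 0 -> (forall i, a i * w = w * b i) ->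
  conj_point w a = b.
Proof.
move=> w0 ab; apply/funext => i.
by apply: (mulrI (w0 : w \is a GRing.unit)); rewrite /conj_point -mulrA mulVKr.
Qed.

Lemma conj_point_qi z : conj_point (qi R) (complex_point z) = complex_point z.
Proof.
apply: conj_pointP qi_neq0 _ => i; apply: quatP;
  by rewrite /= !(mul0r, mulr0, mul1r, mulr1) ?subr0 ?sub0r ?addr0 ?add0r.
Qed.
Lemma conj_point_qj z :
  conj_point (qj R) (complex_point z) = complex_point (conj_complex z).
Proof.
apply: conj_pointP qj_neq0 _ => i; rewrite /complex_point /conj_complex.
case: (z i) => x y; apply: quatP;
  by rewrite /= !(mul0r, mulr0, mul1r, mulr1) ?subr0 ?sub0r ?addr0 ?add0r ?opprK.
Qed.
Lemma conj_point_qk z :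
  conj_point (qk R) (complex_point z) = complex_point (conj_complex z).
Proof.
apply: conj_pointP qk_neq0 _ => i; rewrite /complex_point /conj_complex.
case: (z i) => x y; apply: quatP;
  by rewrite /= !(mul0r, mulr0, mul1r, mulr1) ?subr0 ?sub0r ?addr0 ?add0r ?opprK.
Qed.

Lemma complex_quat_eq0 (c : R[i]) : complex_quat c = 0 -> c = 0.
Proof. by case: c => x y [/= -> ->]. Qed.

(** If the real part f of some P w were not in J, it would be nonzero at some
    complex zero z of the real polynomials in J.  But f is, up to the factor 4,
    the sum of the u P w u^-1 for u = 1, i, j, k, whose values at z involve only
    those of P at z and at its conjugate, another such zero. *)
Lemma core_of_vanishing J P : completely_prime J ->
  (forall z, (forall f, J (real_poly f) -> (toC f).@[z] = 0) ->
    slice_eval P (complex_point z) = 0) ->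
  core J P.
Proof.
move=> cJ; have rJ := cJ.1; move=> P0 w; apply: contrapT.
set f := real_part _ => nJf.
have [z [zJ /eqP fz]] := complex_zero_of_prime (ideal_real_trace rJ)
  (fun f g => @real_trace_prime J f g cJ) nJf.
clear nJf; apply: fz.
have zJ' g : J (real_poly g) -> (toC g).@[conj_complex z] = 0.
  by move=> Jg; rewrite meval_conj (zJ _ Jg) conjc0.
have ca z' := in_slice_commuting (in_slice_complex z').
have Pz := P0 z zJ; have Pz' := P0 _ zJ'.
set P' := P * w%:MP in f *.
have P'z : slice_eval P' (complex_point z) = 0 by exact: slice_evalM0.
have P'z' : slice_eval P' (complex_point (conj_complex z)) = 0 by exact: slice_evalM0.
have term u : u != 0 -> slice_eval P' (conj_point u (complex_point z)) = 0 ->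
    slice_eval (u%:MP * P' * (- u)%:MP) (complex_point z) = 0.
  move=> u0 Pu; apply: slice_evalM0 => //.
  by rewrite slice_evalM_conj // slice_evalC // Pu mulr0.
have := congr1 (fun X => slice_eval X (complex_point z)) (real_partE4 P').
rewrite /= 3!slice_evalD P'z !term ?qi_neq0 ?qj_neq0 ?qk_neq0 //;
  rewrite ?conj_point_qi ?conj_point_qj ?conj_point_qk // !addr0.
rewrite -/f -(raddfMn (@real_poly R n)) slice_eval_real => /complex_quat_eq0/eqP.
by rewrite raddfMn raddfMn -mulr_natl mulf_eq0 Num.Theory.pnatr_eq0 => /eqP.
Qed.

(** The completely prime case of the Nullstellensatz.  In the second case of
    the dichotomy, G^c plays the part of the left factor: it multiplies J into
    J without belonging to J. *)
Lemma vanishing_completely_prime J F : completely_prime J ->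
  (forall a, czero_set J a -> slice_eval F a = 0) -> J F.
Proof.
move=> cJ F0; have rJ := cJ.1; have [[_ _ JM] Jp] := cJ.
have sJ z := in_slice_complex z; have cz z := in_slice_commuting (sJ z).
have [Jcore|[G [JG nJG Gcore]]] := conj_dichotomy rJ rJ (fun G JG => JM _ _ JG).
  apply: (core_sub rJ _); apply: (core_of_vanishing cJ _) => z zJ.
  by apply: F0; apply/czero_setE; split=> // P JP; exact: core_eval0 rJ (Jcore _ JP) zJ.
have [//|//] : J (reg_conj G) \/ J F.
apply: Jp => [|G' JG']; last by apply: (core_sub rJ _); exact: Gcore.
apply: (core_sub rJ _); apply: (core_of_vanishing cJ _) => z zJ.
have [w0|w0] := eqVneq (slice_eval (reg_conj G) (complex_point z)) 0.
  exact: slice_evalM0 (cz z) w0.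
rewrite (slice_evalM_conj _ (cz z) w0) F0 ?mulr0 //.
apply/czero_setE; split; last exact: in_slice_conj.
move=> G' JG'; have := core_eval0 rJ (Gcore _ JG') zJ.
rewrite (slice_evalM_conj _ (cz z) w0) => /eqP; rewrite mulrI_eq0; first by move/eqP.
exact: mulrI.
Qed.

Lemma vanishing_radical I F : is_radical I ->
  (forall a, czero_set I a -> slice_eval F a = 0) -> I F.
Proof.
move=> radI F0; rewrite -radI => J [cJ IJ].
apply: (vanishing_completely_prime cJ _) => a [Ja aK].
by apply: F0; split=> // P IP; apply: Ja; exact: IJ.
Qed.

(** * Spherical symmetry and unions *)

Lemma conj_pointK a w : w != 0 -> conj_point w^-1 (conj_point w a) = a.
Proof.
move=> w0; apply: conj_pointP; first by rewrite invr_eq0.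
move=> i; apply: (mulIr (w0 : w \is a GRing.unit)).
exact: mulrVK.
Qed.

Lemma sphere_zero I1 w a : spherical_symmetry (czero_set I1) -> w != 0 ->
  czero_set I1 a -> czero_set I1 (conj_point w a).
Proof. by move=> sym w0 I1a; rewrite sym; exists a => //; exists w. Qed.

(** The quasi prime ideal I receives the products Q * P, with the factor from
    I1 on the right, where evaluation only moves points within their spheres. *)
Lemma no_symmetric_union I I1 I2 : is_radical I -> quasi_prime I ->
  right_ideal I1 -> right_ideal I2 ->
  czero_set I = czero_set I1 `|` czero_set I2 ->
  spherical_symmetry (czero_set I1) ->
  czero_set I1 `<=` czero_set I2 \/ czero_set I2 `<=` czero_set I1.
Proof.
move=> radI qI rI1 rI2 VI sym; apply: contrapT => /not_orP[].
move=> /existsNP[a /not_implyP[V1a nV2a]] /existsNP[b /not_implyP[V2b nV1b]].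
have /czero_setE[I1a sa] := V1a; have /czero_setE[I2b sb] := V2b.
have [Q I2Q Qa] : exists2 Q, I2 Q & slice_eval Q a <> 0.
  apply: contrapT => noQ; apply: nV2a; apply/czero_setE; split=> // Q I2Q.
  by apply: contrapT => Qa; apply: noQ; exists Q.
have IQP P : I1 P -> I (Q * P).
  move=> I1P; apply: (vanishing_radical radI _) => c; rewrite VI.
  have [Qc Vc|Qc Vc] := eqVneq (slice_eval Q c) 0.
    apply: (slice_evalM0 _ _ Qc); apply: in_slice_commuting.
    by case: Vc => /czero_setE[].
  have sc : in_slice c by case: Vc => /czero_setE[].
  rewrite (slice_evalM_conj _ (in_slice_commuting sc) Qc).
  case: Vc => [V1c|[I2c _]]; last by case/eqP: Qc; exact: I2c.
  have /czero_setE[I1c' _] := sphere_zero sym Qc V1c.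
  by rewrite (I1c' _ I1P) mulr0.
have Isym P : I1 P -> I (symmetrization P).
  move=> /IQP /qI[IQ|//]; case: Qa.
  have : czero_set I a by rewrite VI; left.
  by case=> /(_ _ IQ).
have Vb : czero_set I b by rewrite VI; right.
have cb := in_slice_commuting sb.
have rb := right_ideal_point sb.
have symb P : I1 P -> slice_eval (symmetrization P) b = 0.
  by move=> /Isym IP; case: Vb => Ib _; exact: Ib.
have [I1core|[G [I1G Gb Gcore]]] := conj_dichotomy rI1 rb symb.
  apply: nV1b; apply/czero_setE; split=> // P I1P.
  exact: core_sub rb (I1core _ I1P).
(* The common zero of I1 on the sphere of b is w^-1 b w with w = G^c(b). *)
have w0 : slice_eval (reg_conj G) b != 0 by apply/eqP.
apply: nV1b; rewrite -(conj_pointK b w0); apply: (sphere_zero sym _ _).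
  by rewrite invr_eq0.
apply/czero_setE; split; last exact: in_slice_conj.
move=> P I1P; have := core_sub rb (Gcore _ I1P).
rewrite /= (slice_evalM_conj _ cb w0) => Pb.
apply: (mulrI (w0 : slice_eval _ b \is a GRing.unit)).
exact: etrans Pb (esym (mulr0 _)).
Qed.
End SliceNullstellensatz.

Theorem theorem5p12 (R : realType) (n : nat)
    (I : set {mpoly (quaternion R)[n]})
    (rI : right_ideal I) (qI : quasi_prime I) (radI : is_radical I) :
  ~ exists I1 I2 : set {mpoly (quaternion R)[n]},
      [/\ right_ideal I1 /\ right_ideal I2,
          czero_set I = czero_set I1 `|` czero_set I2,
          ~ (czero_set I1 `<=` czero_set I2),
          ~ (czero_set I2 `<=` czero_set I1)
        & spherical_symmetry (czero_set I1) \/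
          spherical_symmetry (czero_set I2)].
Proof.
move=> [I1 [I2 [[rI1 rI2] VI n12 n21 [sym|sym]]]].
  by have [] := no_symmetric_union radI qI rI1 rI2 VI sym.
rewrite setUC in VI.
by have [] := no_symmetric_union radI qI rI2 rI1 VI sym.
Qed.
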